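(* There is an absolute constant $c>0$ with the following property. Let $v\ge1$ and $\Delta\ge0$ be integers and $0<\epsilon<1$, and set $K=\left\lfloor c\Delta^{3}\ln\frac{v}{\epsilon}\right\rfloor$. Then there exists a function $\Phi=\Phi_{v,\Delta,\epsilon}$ of $K+1$ numbers, with nonzero values, such that for every graph $G$ with $v(G)=v$ vertices and largest vertex degree $\Delta(G)=\Delta$, the number $\Phi(u_0(G),u_1(G),\dots,u_K(G))$ approximates $U(G)$ within relative error $\epsilon$. In words: up to relative error $\epsilon$, $U(G)$ is determined by the numbers $u_k(G)$ with $k\le c(\Delta(G))^3\ln\frac{v(G)}{\epsilon}$.
   Context: Graphs are finite, undirected, without loops or multiple edges. An unbranched subgraph of $G$ is a set of edges of $G$ such that every vertex of $G$ is incident to at most two edges of the set (the empty set included). $u_k(G)$ is the number of unbranched subgraphs with exactly $k$ edges and $U(G)=u_0(G)+u_1(G)+\cdots$ is the total number of unbranched subgraphs. $v(G)$ is the number of vertices and $\Delta(G)$ the largest degree of a vertex. For nonzero complex numbers $a,b$, $b$ approximates $a$ within relative error $\epsilon$ if $a=e^{z}$, $b=e^{w}$ for some complex $z,w$ with $|z-w|\le\epsilon$. *)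

(* Defs.v *)
From HB Require Import structures.
From mathcomp Require Import all_boot all_order all_algebra.
From mathcomp Require Import complex.
From mathcomp Require Import reals sequences exp trigo.

Set Implicit Arguments.
Unset Strict Implicit.
Unset Printing Implicit Defensive.

Import Order.TTheory GRing.Theory Num.Theory.

Record graph := Graph {
  vertex : finType;
  adj : rel vertex;
  adj_sym : symmetric adj;
  adj_irr : irreflexive adj }.

Section Unbranched.
Variable G : graph.

Definition edges : {set {set vertex G}} :=
  [set e | [exists x, exists y, adj x y && (e == [set x; y])]].

Definition degree (x : vertex G) : nat := #|[set y | adj x y]|.

Definition max_degree : nat := \max_(x : vertex G) degree x.

Definition unbranched (F : {set {set vertex G}}) : bool :=
  (F \subset edges) && [forall x, #|[set e in F | x \in e]| <= 2].

Definition num_unbranched_of_size (k : nat) : nat :=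
  #|[set F | unbranched F & #|F| == k]|.

Definition num_unbranched : nat := #|[set F | unbranched F]|.

Lemma num_unbranchedE :
  num_unbranched = \sum_(k < #|edges|.+1) num_unbranched_of_size k.
Proof.
rewrite /num_unbranched -sum1_card.
rewrite (partition_big (fun F : {set {set vertex G}} => inord #|F| : 'I_#|edges|.+1) xpredT) //=.
apply: eq_bigr => k _; rewrite sum1_card; apply: eq_card => F.
rewrite [LHS]unfold_in /= !inE; case: (boolP (unbranched F)) => //= /andP[sFE _].
by rewrite -val_eqE /= inordK // ltnS subset_leq_card.
Qed.

End Unbranched.

Local Open Scope ring_scope.
Local Open Scope complex_scope.

Definition cexp (R : realType) (z : R[i]) : R[i] :=
  let: x +i* y := z in (expR x * cos y) +i* (expR x * sin y).

(* [b] approximates [a] within relative error [eps]; both are then nonzero,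
   and the norm of [R[i]] takes its values in [R[i]]. *)
Definition approximates (R : realType) (b a : R[i]) (eps : R) : Prop :=
  exists z w : R[i], [/\ a = cexp z, b = cexp w & `|z - w| <= eps%:C].

(* Main.v *)
Require Import Defs.
From HB Require Import structures.
From mathcomp Require Import all_boot all_order all_algebra.
From mathcomp Require Import complex ring lra.
From mathcomp Require Import boolp reals topology normedtype derive realfun.
From mathcomp Require Import sequences exp trigo.

(* Asano-Ruelle contraction shows that sum_k u_k(G) z^k has no zero with
   Re z > -1/(2 D^3). At each vertex the sum over sets of at most two incident
   edges does not vanish when every variable lies in a half-plane H slightly
   larger than one through 0. Identifying the variables of the two ends of an
   edge keeps the polynomial nonzero for z in a parabola with focus 0, and the
   parabolas coming from all admissible directions of H cover the half-plane
   Re z > -1/(2 D^3).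
   A Moebius map turns the polynomial into a product of factors 1 - eta w with
   |eta| <= 1 and the point z = 1 into some w with 1 - w of order D^-3. The
   coefficients up to order K determine the first K power sums of the eta, i.e.
   the logarithmic derivative up to O(n w^K / (1 - w)). So any two graphs with
   the same u_0, ..., u_K have nearly the same ln U, and Phi may take the value
   of U at an arbitrary graph with the given numbers. *)

Import Order.TTheory GRing.Theory Num.Theory numFieldNormedType.Exports.
Local Open Scope ring_scope.
Local Open Scope complex_scope.

Set Implicit Arguments.
Unset Strict Implicit.
Unset Printing Implicit Defensive.

(* [Num.Theory] shadows the projections of [R[i]] by the algebraic ['Re], ['Im]. *)
Local Notation Re := (@complex.Re _).
Local Notation Im := (@complex.Im _).

(** * Zero-free half-plane *)

Lemma sum_sqr_le_sqr_sum (R : realFieldType) (I : finType) (A : {set I})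
    (a : I -> R) :
  (forall i, i \in A -> 0 <= a i) ->
  \sum_(i in A) a i ^+ 2 <= (\sum_(i in A) a i) ^+ 2.
Proof.
move=> a0; rewrite expr2 mulr_suml; apply: ler_sum => i iA.
rewrite expr2 ler_wpM2l ?a0 // (bigD1 i) //= lerDl sumr_ge0 // => j /andP[jA _].
exact: a0.
Qed.

(* Subtracting from [b] the multiple of [a] that makes the coordinates sum to
   [0] gives a vector on which the form [e2] is visibly nonpositive. *)
Lemma reversed_cauchy_e2 (R : realFieldType) (I : finType) (A : {set I})
    (a b : I -> R) :
  let X := (\sum_(i in A) a i) ^+ 2 - \sum_(i in A) a i ^+ 2 in
  let Y := (\sum_(i in A) b i) ^+ 2 - \sum_(i in A) b i ^+ 2 in
  let B := (\sum_(i in A) a i) * (\sum_(i in A) b i) - \sum_(i in A) a i * b i in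
  0 < X -> X * Y <= B ^+ 2.
Proof.
set sa := \sum_(i in A) a i; set sb := \sum_(i in A) b i.
set qa := \sum_(i in A) a i ^+ 2; set qb := \sum_(i in A) b i ^+ 2.
set g := \sum_(i in A) a i * b i => X Y B X0.
have qa0 : 0 <= qa by apply: sumr_ge0 => i _; exact: sqr_ge0.
have sa0 : sa != 0.
  by apply: contraTneq X0 => h; rewrite /X h expr0n /= sub0r -leNgt oppr_le0.
pose t := sb / sa.
have h : 0 <= qb - 2 * t * g + t ^+ 2 * qa.
  suff -> : qb - 2 * t * g + t ^+ 2 * qa = \sum_(i in A) (b i - t * a i) ^+ 2.
    by apply: sumr_ge0 => i _; exact: sqr_ge0.
  rewrite /qb /g /qa !mulr_sumr -sumrB -big_split /=.
  by apply: eq_bigr => i _; ring.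
have e : Y - 2 * t * B + t ^+ 2 * X = - (qb - 2 * t * g + t ^+ 2 * qa).
  by rewrite /Y /B /X /t; field.
have : X * (Y - 2 * t * B + t ^+ 2 * X) <= 0.
  by rewrite pmulr_rle0 // e oppr_le0.
have -> : X * (Y - 2 * t * B + t ^+ 2 * X) = X * Y - B ^+ 2 + (t * X - B) ^+ 2.
  by ring.
by have := sqr_ge0 (t * X - B); lra.
Qed.

Lemma Re_sum (R : rcfType) (I : finType) (A : {set I}) (f : I -> R[i]) :
  Re (\sum_(i in A) f i) = \sum_(i in A) Re (f i).
Proof. by elim/big_rec2: _ => // i y [? ?] _ <-; case: (f i). Qed.

Lemma Im_sum (R : rcfType) (I : finType) (A : {set I}) (f : I -> R[i]) :
  Im (\sum_(i in A) f i) = \sum_(i in A) Im (f i).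
Proof. by elim/big_rec2: _ => // i y [? ?] _ <-; case: (f i). Qed.

(** For a unit normal [(p, q)] the boundary line lies at distance [s] beyond 0, so 0 is inside
    exactly when [s] is positive. *)
Definition half_plane (R : rcfType) (p q s : R) (u : R[i]) : bool :=
  - s < p * Re u + q * Im u.

(* Centring the variables removes the linear part of the quadratic polynomial;
   the imaginary and real parts of a zero then contradict the reversed Cauchy
   inequality. *)
Lemma vertex_poly_neq0 (R : rcfType) (I : finType) (A : {set I}) (D : nat)
    (p q s : R) (u : I -> R[i]) :
  p ^+ 2 + q ^+ 2 = 1 -> 0 < s ->
  s * D%:R ^+ 2 + `|q| * (D%:R - 1) <= p * D%:R -> (#|A| <= D)%N ->
  (forall i, i \in A -> half_plane p q s (u i)) ->
  2 + 2 * (\sum_(i in A) u i)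
    + ((\sum_(i in A) u i) ^+ 2 - \sum_(i in A) u i ^+ 2) != 0.
Proof.
move=> pq1 s0 sD AD uH; set d := #|A| in AD.
have [d0|d0] := posnP d.
  have /eqP -> : A == set0 by rewrite -cards_eq0; apply/eqP.
  by rewrite !big_set0 expr0n /= mulr0 subr0 !addr0 pnatr_eq0.
have D1 : 1 <= D%:R :> R by rewrite ler1n (leq_trans d0).
have q0 := normr_ge0 q.
(* The left side grows with [D], so the inequality passes to the actual number [d] of variables. *)
have sp : s * D%:R + `|q| * (1 - D%:R^-1) <= p.
  have DD : 0 < D%:R :> R by lra.
  have -> : s * D%:R + `|q| * (1 - D%:R^-1)
          = (s * D%:R ^+ 2 + `|q| * (D%:R - 1)) / D%:R by field; lra.
  by rewrite ler_pdivrMr.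
(* A single variable leaves [2 + 2 u], whose zero -1 is outside because [s <= p]. *)
have [d1|d1] := eqVneq d 1.
  have /cards1P[i Ai] : #|A| == 1%N by apply/eqP.
  rewrite Ai !big_set1 subrr addr0.
  have := uH i; rewrite Ai inE eqxx => /(_ isT); rewrite /half_plane.
  apply: contraTneq; rewrite -{1}[2]mulr1 -mulrDr => /eqP.
  rewrite mulf_eq0 pnatr_eq0 /= addrC addr_eq0 => /eqP ->.
  rewrite -leNgt /=.
  have : 0 <= 1 - D%:R^-1 :> R by rewrite subr_ge0 invf_le1 //; lra.
  move: sp; set k := 1 - _ => sp k0.
  have : s <= s * D%:R by rewrite ler_peMr // ltW.
  by have : 0 <= `|q| * k by [exact: mulr_ge0]; lra.
have d2 : 2 <= d%:R :> R by rewrite ler_nat ltn_neqAle eq_sym d1.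
have dD : d%:R <= D%:R :> R by rewrite ler_nat.
pose n : R := d%:R; pose n1 := n - 1.
have n10 : 0 < n1 by rewrite /n1 /n; lra.
(* Lower bound for the real parts of the centred and rotated variables [w i] below. *)
pose m := p / n1 - s.
have mq : `|q| / n + s / n1 <= m.
  rewrite /m -lerBrDr.
  have -> : p / n1 - s - s / n1 = (p - s * n) / n1 by rewrite /n1 in n10 *; field; lra.
  rewrite ler_pdivlMr //.
  have -> : `|q| / n * n1 = `|q| * (1 - n^-1) by rewrite /n1 /n; field; lra.
  have : D%:R^-1 <= n^-1 by rewrite lef_pV2 ?posrE /n //; lra.
  have : s * n <= s * D%:R by rewrite ler_wpM2l // ltW.
  move=> h1 h2; have : `|q| * (1 - n^-1) <= `|q| * (1 - D%:R^-1).
    by rewrite ler_wpM2l //; lra.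
  lra.
have sn0 : 0 < s / n1 by exact: divr_gt0.
have qn0 : 0 <= `|q| / n by rewrite divr_ge0 // /n; lra.
have m0 : 0 < m by lra.
apply/eqP => eq0.
(* Value of the polynomial at its centre, where every [u i] is [- n1^-1]; multiplication by [om]
   turns the normal of the half-plane into the real axis. *)
pose k := (n - 2) / n1.
pose om : R[i] := p -i* q.
pose w i := om * (u i + (n1^-1)%:C).
have wE : (\sum_(i in A) w i) ^+ 2 - \sum_(i in A) w i ^+ 2
          = - (om ^+ 2 * k%:C).
  have n1C : n%:C - 1 != 0 :> R[i].
    rewrite -(rmorph1 (real_complex R)) -rmorphB /= -(rmorph0 (real_complex R)).
    by rewrite (inj_eq (@complexI R)) gt_eqF.
  have n1V : (n1^-1)%:C = n1%:C^-1 by rewrite fmorphV.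
  have -> : \sum_(i in A) w i = om * (\sum_(i in A) u i + n%:C / n1%:C).
    rewrite -mulr_sumr big_split /= sumr_const -/d; congr (_ * (_ + _)).
    by rewrite -mulr_natl /n rmorph_nat n1V.
  have -> : \sum_(i in A) w i ^+ 2 = om ^+ 2 * (\sum_(i in A) u i ^+ 2
      + 2 * (\sum_(i in A) u i) / n1%:C + n%:C / n1%:C ^+ 2).
    rewrite (eq_bigr (fun i => om ^+ 2 * (u i ^+ 2 + 2 * u i / n1%:C + n1%:C^-1 ^+ 2))).
      rewrite -mulr_sumr !big_split /= sumr_const -/d -mulr_suml -mulr_sumr.
      by congr (_ * (_ + _)); rewrite -mulr_natl /n rmorph_nat exprVn.
    by move=> i _; rewrite /w n1V; ring.
  have -> : k%:C = (n%:C - 2) / n1%:C.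
    by rewrite /k rmorphM /= n1V rmorphB /= !rmorph_nat.
  rewrite /n1 rmorphB /= rmorph1.
  move: eq0; set S := \sum_(i in A) u i; set T := \sum_(i in A) _ => eq0.
  have -> : T = 2 + 2 * S + S ^+ 2.
    by apply/eqP; rewrite eq_sym -subr_eq0 -[X in _ == X]eq0; apply/eqP; ring.
  by field; move: n1C; rewrite /n rmorph_nat.
pose a i := Re (w i); pose b i := Im (w i).
pose X := (\sum_(i in A) a i) ^+ 2 - \sum_(i in A) a i ^+ 2.
pose Y := (\sum_(i in A) b i) ^+ 2 - \sum_(i in A) b i ^+ 2.
pose B := (\sum_(i in A) a i) * (\sum_(i in A) b i) - \sum_(i in A) a i * b i.
have XYE : X - Y = - (k * (p ^+ 2 - q ^+ 2)).
  have := congr1 (@complex.Re R) wE.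
  have -> : Re (- (om ^+ 2 * k%:C)) = - (k * (p ^+ 2 - q ^+ 2)).
    by rewrite expr2 /om /=; ring.
  move=> <-.
  have ReB (x y : R[i]) : Re (x - y) = Re x - Re y by case: x y => ? ? [].
  rewrite ReB Re_sum.
  have Re2 (x : R[i]) : Re (x ^+ 2) = Re x ^+ 2 - Im x ^+ 2.
    by case: x => ? ?; rewrite expr2 /=; ring.
  rewrite Re2 Re_sum Im_sum /X /Y.
  under [X in _ = _ - X]eq_bigr do rewrite Re2.
  by rewrite sumrB /a /b; ring.
have BE : B = k * p * q.
  have := congr1 (@complex.Im R) wE.
  have -> : Im (- (om ^+ 2 * k%:C)) = 2 * (k * p * q).
    by rewrite expr2 /om /=; ring.
  have ImB (x y : R[i]) : Im (x - y) = Im x - Im y by case: x y => ? ? [].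
  rewrite ImB Im_sum.
  have Im2 (x : R[i]) : Im (x ^+ 2) = 2 * (Re x * Im x) by case: x => ? ?; rewrite expr2 /=; ring.
  rewrite Im2 Re_sum Im_sum /B.
  under [X in _ - X = _ -> _]eq_bigr do rewrite Im2.
  by rewrite -mulr_sumr /a /b; lra.
(* With [a i = m + c i] and [c] nonnegative on [A], everything beyond the constant term is
   nonnegative. *)
have Xm : n * n1 * m ^+ 2 <= X.
  have [c c0 ac] : exists2 c : I -> R,
      forall i, i \in A -> 0 <= c i & forall i, a i = m + c i.
    exists (fun i => a i - m) => i; last by rewrite addrC subrK.
    move=> /uH; rewrite /half_plane /a /w /om subr_ge0 => h; apply/ltW.
    move: h; case: (u i) => ux uy /=; rewrite /m; set k1 := n1^-1.
    lra.
  have -> : X = n * n1 * m ^+ 2 + 2 * n1 * m * (\sum_(i in A) c i)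
        + ((\sum_(i in A) c i) ^+ 2 - \sum_(i in A) c i ^+ 2).
    have sum_const (x : R) : \sum_(i in A) x = n * x.
      by rewrite sumr_const mulr_natl.
    rewrite /X; under eq_bigr do rewrite ac.
    rewrite big_split /= sum_const.
    under [X in _ - X = _]eq_bigr do rewrite ac sqrrD -mulr_natl mulrA.
    by rewrite !big_split /= !sum_const -mulr_sumr /n1; ring.
  have s1 : 0 <= \sum_(i in A) c i by exact: sumr_ge0.
  have := sum_sqr_le_sqr_sum c0.
  have : 0 <= 2 * n1 * m * \sum_(i in A) c i.
    by rewrite !mulr_ge0 // ltW.
  lra.
have n0 : 0 < n by rewrite /n; lra.
have X0 : 0 < X by apply: lt_le_trans Xm; rewrite !mulr_gt0 // exprn_gt0.
have := @reversed_cauchy_e2 R I A a b X0; rewrite -/X -/Y -/B => XYB.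
have k0 : 0 <= k by rewrite /k divr_ge0 ?(ltW n10) // /n; lra.
(* Eliminating [Y] and [B] turns the reversed Cauchy inequality into a product of two factors, the
   first of them positive. *)
have Xk : X <= k * q ^+ 2.
  have h : (X + k * p ^+ 2) * (X - k * q ^+ 2) <= 0.
    move: XYB; have -> : Y = X + k * (p ^+ 2 - q ^+ 2) by lra.
    by rewrite BE -subr_le0; congr (_ <= _); ring.
  rewrite -subr_le0 -(pmulr_rle0 _ (x := X + k * p ^+ 2)) //.
  by have := mulr_ge0 k0 (sqr_ge0 p); lra.
have mq2 : q ^+ 2 / n ^+ 2 < m ^+ 2.
  rewrite -real_normK ?num_real // -expr_div_n ltr_pXn2r ?nnegrE //; last exact: ltW.
  lra.
have : n * n1 * (q ^+ 2 / n ^+ 2) < k * q ^+ 2.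
  apply: lt_le_trans Xk; apply: lt_le_trans Xm; rewrite ltr_pM2l //; exact: mulr_gt0.
rewrite ltNge => /negP; apply.
have -> : n * n1 * (q ^+ 2 / n ^+ 2) = n1 / n * q ^+ 2 by field; lra.
(* Amounts to [n (n - 2) <= (n - 1)^2]. *)
rewrite ler_wpM2r ?sqr_ge0 // /k ler_pdivrMr // mulrAC ler_pdivlMr // /n1; nra.
Qed.

(* |z| - Re (z / (p + iq)^2) < 2 s^2 is the interior of a parabola with focus 0;
   it omits the opposites of all products of two points outside the half-plane. *)
Lemma asano_contraction_neq0 (R : rcfType) (p q s : R) (a b c d z : R[i]) :
  p ^+ 2 + q ^+ 2 = 1 -> 0 < s ->
  Num.sqrt (Re z ^+ 2 + Im z ^+ 2)
    - ((p ^+ 2 - q ^+ 2) * Re z + 2 * p * q * Im z) < 2 * s ^+ 2 ->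
  (forall u v, half_plane p q s u -> half_plane p q s v ->
     a + b * u + c * v + d * (u * v) != 0) ->
  a + d * z != 0.
Proof.
move=> pq1 s0 zs nz.
have [->|d0] := eqVneq d 0.
  have := nz 0 0; rewrite !mulr0 mul0r !addr0 /half_plane /= !mulr0 addr0 oppr_lt0.
  by apply.
apply/eqP => eq0.
(* On the diagonal [u = v] the polynomial is [d (x^2 + 2 be x + g)]. Both its zeros lie outside the
   half-plane, and their product [g] is [- z] when [a + d z = 0]. *)
pose be := (b + c) / (2 * d); pose g := a / d.
pose r := sqrtc (be ^+ 2 - g).
have rE : r ^+ 2 = be ^+ 2 - g by exact: sqr_sqrtc.
have out (x : R[i]) : x ^+ 2 + 2 * be * x + g = 0 -> ~~ half_plane p q s x.
  move=> x0; apply/negP => xH; have /eqP := nz _ _ xH xH; apply.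
  suff -> : a + b * x + c * x + d * (x * x) = d * (x ^+ 2 + 2 * be * x + g).
    by rewrite x0 mulr0.
  by rewrite /be /g; field.
have := out (- be + r); have := out (- be - r).
have -> : (- be - r) ^+ 2 + 2 * be * (- be - r) + g = 0.
  by transitivity (r ^+ 2 - (be ^+ 2 - g)); [ring | rewrite rE subrr].
have -> : (- be + r) ^+ 2 + 2 * be * (- be + r) + g = 0.
  by transitivity (r ^+ 2 - (be ^+ 2 - g)); [ring | rewrite rE subrr].
move=> /(_ erefl) + /(_ erefl).
have : (- be - r) * (- be + r) = - z.
  transitivity (be ^+ 2 - r ^+ 2); first by ring.
  rewrite rE opprB addrC subrK /g; apply: (mulfI d0); rewrite mulrC divfK //.
  by apply/eqP; rewrite mulrN -addr_eq0 eq0.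
case: (- be - r) (- be + r) => [x1 y1] [x2 y2]; case: z zs {eq0} => x y zs [].
rewrite /half_plane -!leNgt /= => e1 e2 h1 h2.
suff : 2 * s ^+ 2 <= Num.sqrt (x ^+ 2 + y ^+ 2)
    - ((p ^+ 2 - q ^+ 2) * x + 2 * p * q * y) by rewrite leNgt zs.
(* [a1 + i b1] and [a2 + i b2] are the opposites of the two zeros, rotated by [p - i q]; lying
   outside the half-plane means a real part of at least [s]. *)
pose a1 := - (p * x1 + q * y1); pose b1 := - (p * y1 - q * x1).
pose a2 := - (p * x2 + q * y2); pose b2 := - (p * y2 - q * x2).
have xE : x = - (x1 * x2 - y1 * y2) by rewrite e1 opprK.
have yE : y = - (x1 * y2 + y1 * x2) by rewrite e2 opprK.
have nE : x ^+ 2 + y ^+ 2 = (a1 ^+ 2 + b1 ^+ 2) * (a2 ^+ 2 + b2 ^+ 2).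
  transitivity ((p ^+ 2 + q ^+ 2) ^+ 2 * ((x1 ^+ 2 + y1 ^+ 2) * (x2 ^+ 2 + y2 ^+ 2))).
    by rewrite pq1 xE yE; ring.
  by rewrite /a1 /b1 /a2 /b2; ring.
have lE : (p ^+ 2 - q ^+ 2) * x + 2 * p * q * y = - (a1 * a2 - b1 * b2).
  by rewrite xE yE /a1 /b1 /a2 /b2; ring.
have a1s : s <= a1 by rewrite /a1; lra.
have a2s : s <= a2 by rewrite /a2; lra.
(* Cauchy-Schwarz; subtracting the linear term [lE] leaves at least [2 a1 a2]. *)
have : a1 * a2 + b1 * b2 <= Num.sqrt (x ^+ 2 + y ^+ 2).
  apply: le_trans (ler_norm _) _; rewrite -sqrtr_sqr ler_wsqrtr // nE.
  by have := sqr_ge0 (a1 * b2 - b1 * a2); nra.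
have : s ^+ 2 <= a1 * a2 by rewrite expr2 ler_pM // ltW.
by rewrite lE; lra.
Qed.

(* Directions: along the axis, at 45 degrees from it, or along sqrt z. *)
Lemma parabolas_cover_half_plane (R : rcfType) (D : nat) (z : R[i]) :
  (0 < D)%N -> - (2 * D%:R ^+ 3)^-1 < Re z ->
  exists p q s : R, [/\ p ^+ 2 + q ^+ 2 = 1, 0 < s,
    s * D%:R ^+ 2 + `|q| * (D%:R - 1) <= p * D%:R &
    Num.sqrt (Re z ^+ 2 + Im z ^+ 2)
      - ((p ^+ 2 - q ^+ 2) * Re z + 2 * p * q * Im z) < 2 * s ^+ 2].
Proof.
case: z => x y /= D0; set n : R := D%:R => xn.
have n1 : 1 <= n by rewrite /n ler1n.
set N := Num.sqrt _.
have N0 : 0 <= N by exact: sqrtr_ge0.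
have NE : N ^+ 2 = x ^+ 2 + y ^+ 2 by rewrite sqr_sqrtr // addr_ge0 ?sqr_ge0.
have [x0|x0] := leP 0 x.
  have [N00|N00] := eqVneq N 0.
    exists 1, 0, n^-1; split; [by rewrite expr0n /= expr1n addr0 | by rewrite invr_gt0; lra | |].
      by rewrite normr0 mul0r addr0 mul1r expr2 mulrA mulVf ?mul1r //; lra.
    have [-> ->] : x = 0 /\ y = 0 by move: NE; rewrite N00; nra.
    rewrite N00 !mulr0 addr0 subr0 mulr_gt0 // exprn_gt0 // invr_gt0; lra.
  have Np : 0 < N by rewrite lt_def N00.
  (* Half-angle formulas: [p + i q] is a square root of [z / N], which makes the left side of the
     parabola inequality vanish. *)
  pose p := Num.sqrt ((1 + x / N) / 2).
  have xN0 : 0 <= x / N by exact: divr_ge0.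
  have p2 : p ^+ 2 = (1 + x / N) / 2 by rewrite sqr_sqrtr //; lra.
  have p0 : 0 < p by rewrite sqrtr_gt0; lra.
  pose q := y / (2 * N * p).
  have q2 : q ^+ 2 = (1 - x / N) / 2.
    rewrite /q expr_div_n !exprMn p2.
    have -> : y ^+ 2 = N ^+ 2 - x ^+ 2 by rewrite NE; ring.
    field; rewrite N00 /= gt_eqF //; lra.
  have qp : `|q| <= p.
    rewrite -(ler_pXn2r (n := 2)) ?nnegrE ?(ltW p0) //.
    by rewrite real_normK ?num_real // p2 q2; lra.
  (* The largest [s] that the third condition allows; it is positive because [|q| <= p]. *)
  exists p, q, ((p * n - `|q| * (n - 1)) / n ^+ 2); split.
  - by rewrite p2 q2; field.
  - rewrite divr_gt0 //; last by rewrite exprn_gt0 //; lra.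
    have : `|q| * (n - 1) <= p * (n - 1) by rewrite ler_wpM2r // subr_ge0.
    lra.
  - by rewrite divfK ?subrK // expf_neq0 //; lra.
  - have -> : N - ((p ^+ 2 - q ^+ 2) * x + 2 * p * q * y) = 0.
      have -> : 2 * p * q * y = y ^+ 2 / N by rewrite /q; field; rewrite N00 gt_eqF.
      have -> : y ^+ 2 = N ^+ 2 - x ^+ 2 by rewrite NE; ring.
      by rewrite p2 q2; field.
    rewrite mulr_gt0 // exprn_gt0 // divr_gt0 //; last by rewrite exprn_gt0 //; lra.
    have : `|q| * (n - 1) <= p * (n - 1) by rewrite ler_wpM2r // subr_ge0.
    lra.
pose m := n^-1; have m0 : 0 < m by rewrite invr_gt0; lra.
have m1 : m <= 1 by rewrite invf_le1; lra.
have mn : m * n = 1 by rewrite mulVf //; lra.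
have xm : - x < m ^+ 3 / 2.
  have -> : m ^+ 3 / 2 = (2 * n ^+ 3)^-1 by rewrite /m; field; lra.
  lra.
have m32 : m ^+ 3 <= m ^+ 2 by rewrite exprS ler_piMl // exprn_ge0 // ltW.
(* Close to the axis the axial direction works: [N - x <= |y| - 2 x < m^2 + m^3 <= 2 m^2]. *)
have [ym|ym] := leP `|y| (m ^+ 2).
  exists 1, 0, m; split => //; [by rewrite expr0n /= expr1n addr0 | |].
    by rewrite normr0 mul0r addr0 expr2 mulrA mn !mul1r.
  have : N <= `|y| - x.
    rewrite -(ler_pXn2r (n := 2)) ?nnegrE //; last by have := normr_ge0 y; lra.
    rewrite NE -[y ^+ 2]real_normK ?num_real //; have := normr_ge0 y; nra.
  lra.
pose p : R := Num.sqrt 2^-1.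
have p2 : p ^+ 2 = 2^-1 by rewrite sqr_sqrtr // invr_ge0.
have p0 : 0 < p by rewrite sqrtr_gt0 invr_gt0.
pose q := if 0 <= y then p else - p.
have nq : `|q| = p by rewrite /q; case: ifP; rewrite ?normrN gtr0_norm.
have q2 : q ^+ 2 = 2^-1 by rewrite /q; case: ifP; rewrite ?sqrrN.
have qy : 2 * p * q * y = `|y|.
  transitivity (2 * p ^+ 2 * (if 0 <= y then y else - y)).
    by rewrite /q; case: ifP => _; ring.
  rewrite p2 mulfV ?mul1r ?pnatr_eq0 //.
  by case: (lerP 0 y) => y0; rewrite ?(ger0_norm y0) ?(ltr0_norm y0).
(* Again the largest admissible [s], with [2 s^2 = m^4]. It suffices that [x^2 < m^6 / 4], since
   [2 m^4 |y|] is at least [2 m^6]. *)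
exists p, q, (p * m ^+ 2); split.
- by rewrite p2 q2; field.
- by rewrite mulr_gt0 // exprn_gt0.
- rewrite nq -mulrA -exprMn mn expr1n; lra.
- rewrite qy p2 q2 subrr mul0r add0r exprMn p2.
  have -> : 2 * (2^-1 * (m ^+ 2) ^+ 2) = m ^+ 4 by field.
  rewrite ltrBlDr -(ltr_pXn2r (n := 2)) ?nnegrE //; last first.
    by rewrite addr_ge0 // exprn_ge0 // ltW.
  rewrite NE -[y ^+ 2]real_normK ?num_real //.
  have -> : (m ^+ 4 + `|y|) ^+ 2 = m ^+ 8 + 2 * m ^+ 4 * `|y| + `|y| ^+ 2 by ring.
  rewrite ltrD2r.
  have x2 : x ^+ 2 < (m ^+ 3 / 2) ^+ 2.
    by rewrite -sqrrN ltr_pXn2r ?nnegrE //; lra.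
  have m4 : 0 < m ^+ 4 by exact: exprn_gt0.
  have m8 : 0 < m ^+ 8 by exact: exprn_gt0.
  have : m ^+ 4 * m ^+ 2 <= m ^+ 4 * `|y| by rewrite ler_wpM2l // ltW.
  have -> : m ^+ 4 * m ^+ 2 = m ^+ 6 by rewrite -exprD.
  move: x2; rewrite expr_div_n -exprM.
  have : 0 < m ^+ 6 by exact: exprn_gt0.
  lra.
Qed.

(* The uncontracted sum is the value at (u, v) of a multiaffine polynomial with
   one pair of variables per index; the conclusion contracts every pair. *)
Lemma asano_contraction_sum_neq0 (K : comNzRingType) (S I : finType)
    (H : pred K) (z : K) (w : S -> K) (pr : I -> S -> bool * bool) :
  H 0 ->
  (forall a b c d : K,
     (forall u v, H u -> H v -> a + b * u + c * v + d * (u * v) != 0) ->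
     a + d * z != 0) ->
  (forall u v : I -> K, (forall i, H (u i)) -> (forall i, H (v i)) ->
     \sum_s w s * \prod_i (u i ^+ (pr i s).1 * v i ^+ (pr i s).2) != 0) ->
  \sum_s w s * \prod_i (((pr i s).1 == (pr i s).2)%:R * z ^+ (pr i s).1) != 0.
Proof.
move=> H0 contract nz.
(* Pairs listed in [l] are already contracted, the others still carry two free variables; the
   induction contracts one pair at a time. *)
pose g (l : seq I) (u v : I -> K) i (b : bool * bool) :=
  if i \in l then (b.1 == b.2)%:R * z ^+ b.1 else u i ^+ b.1 * v i ^+ b.2.
suff key (l : seq I) (u v : I -> K) : (forall i, H (u i)) -> (forall i, H (v i)) ->
    \sum_s w s * \prod_i g l u v i (pr i s) != 0.
  have := key (enum I) (fun=> 0) (fun=> 0) (fun=> H0) (fun=> H0).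
  by under eq_bigr do under eq_bigr do rewrite /g mem_enum inE.
elim: l u v => [|j l IH] u v Hu Hv; first exact: nz.
have [jl|jl] := boolP (j \in l).
  have gE i b : g (j :: l) u v i b = g l u v i b.
    rewrite /g (_ : (i \in j :: l) = (i \in l)) // in_cons.
    by case: eqVneq => // ->; rewrite jl.
  by under eq_bigr do under eq_bigr do rewrite gE; exact: IH.
pose rest s := w s * \prod_(i | i != j) g l u v i (pr i s).
(* The four coefficients of the sum as a polynomial in the variables of pair [j]; contraction keeps
   only the first and the last. *)
pose E b := \sum_(s | pr j s == b) rest s.
have split (h : bool * bool -> K) : \sum_s h (pr j s) * rest s
    = h (false, false) * E (false, false) + h (true, false) * E (true, false)
      + h (false, true) * E (false, true) + h (true, true) * E (true, true).
  rewrite (partition_big (pr j) xpredT) //=.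
  rewrite (eq_bigr (fun b => h b * E b)); last first.
    by move=> b _; rewrite mulr_sumr; apply: eq_bigr => s /eqP ->.
  rewrite (eq_bigr (fun b => h (b.1, b.2) * E (b.1, b.2))) => [|[] //].
  rewrite -(pair_bigA _ (fun b1 b2 => h (b1, b2) * E (b1, b2))) /= !big_bool /=.
  ring.
have pull l' u' v' : (forall i, i != j -> g l' u' v' i =1 g l u v i) ->
    \sum_s w s * \prod_i g l' u' v' i (pr i s)
    = \sum_s g l' u' v' j (pr j s) * rest s.
  move=> gE; apply: eq_bigr => s _; rewrite (bigD1 j) //= mulrCA; congr (_ * (_ * _)).
  by apply: eq_bigr => i ij; exact: gE.
rewrite pull => [|i ij b]; last by rewrite /g in_cons (negbTE ij).
rewrite split /g in_cons eqxx /= !expr0 !expr1 !mul1r !mul0r !addr0 [z * _]mulrC.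
apply: (contract _ (E (true, false)) (E (false, true))) => x y Hx Hy.
pose u' i := if i == j then x else u i; pose v' i := if i == j then y else v i.
have := IH u' v'; rewrite pull => [|i ij b]; last first.
  by rewrite /g /u' /v' (negbTE ij).
rewrite split /g (negbTE jl) /u' /v' eqxx /= !expr0 !expr1 !mulr1 !mul1r.
rewrite [x * y * _]mulrC [x * _]mulrC [y * _]mulrC; apply => i; by case: eqP.
Qed.

(** Newton's identity [2 e_2 = p_1^2 - p_2]; it brings the local polynomial of a vertex to the form
    treated by [vertex_poly_neq0]. *)
Lemma sum_subsets_le2 (K : comNzRingType) (T : finType) (A : {set T}) (f : T -> K) :
  2 * \sum_(B : {set T} | (B \subset A) && (#|B| <= 2)%N) \prod_(i in B) f i
  = 2 + 2 * (\sum_(i in A) f i)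
    + ((\sum_(i in A) f i) ^+ 2 - \sum_(i in A) f i ^+ 2).
Proof.
pose P k := \sum_(B : {set T} | (B \subset A) && (#|B| == k)) \prod_(i in B) f i.
have -> : \sum_(B : {set T} | (B \subset A) && (#|B| <= 2)%N) \prod_(i in B) f i
          = P 0 + P 1 + P 2.
  rewrite (bigID (fun B : {set T} => #|B| == 0)) /= -addrA; congr (_ + _).
    by apply: eq_bigl => B; rewrite -!andbA; congr andb; case: #|B| => [|[|[|]]].
  rewrite (bigID (fun B : {set T} => #|B| == 1)) /=; congr (_ + _).
    by apply: eq_bigl => B; rewrite -!andbA; congr andb; case: #|B| => [|[|[|]]].
  by apply: eq_bigl => B; rewrite -!andbA; congr andb; case: #|B| => [|[|[|]]].
have P0 : P 0 = 1.
  rewrite /P (big_pred1 set0) ?big_set0 // => B.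
  by rewrite cards_eq0 /= andbC; case: eqVneq => // ->; rewrite sub0set.
have P1 : P 1 = \sum_(i in A) f i.
  transitivity (\sum_(B in set1 @: A) \prod_(i in B) f i); last first.
    rewrite big_imset /=; last by move=> i j _ _ /set1_inj.
    by apply: eq_bigr => i _; rewrite big_set1.
  apply: eq_bigl => B; apply/andP/imsetP => [[BA /cards1P[x Bx]]|[x xA ->]].
    by exists x => //; move: BA; rewrite Bx sub1set.
  by rewrite sub1set cards1.
have P2 : 2 * P 2 = \sum_(p | [&& p.1 \in A, p.2 \in A & p.1 != p.2]) f p.1 * f p.2.
  rewrite [RHS](partition_big (fun p => [set p.1; p.2])
    (fun B : {set T} => (B \subset A) && (#|B| == 2))) /=; last first.
    by move=> [x y] /= /and3P[xA yA xy]; rewrite subUset !sub1set xA yA cards2 xy.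
  rewrite mulr_sumr; apply: eq_bigr => B /andP[BA /cards2P[x [y [xy BE]]]].
  have [xA yA] : x \in A /\ y \in A by split; apply: (subsetP BA); rewrite BE !inE eqxx ?orbT.
  rewrite (bigD1 (x, y)) /=; last by rewrite xA yA xy BE eqxx.
  rewrite (bigD1 (y, x)) /=; last first.
    by rewrite xA yA eq_sym xy BE setUC eqxx xpair_eqE [y == x]eq_sym (negbTE xy).
  rewrite [X in _ + (_ + X)]big1 ?addr0.
    by rewrite BE big_setU1 ?inE //= big_set1; ring.
  move=> [a b] /= /andP[/andP[/andP[/and3P[aA bA ab] /eqP sE] n1] n2].
  have : (a \in B) && (b \in B) by rewrite -sE !inE !eqxx orbT.
  rewrite BE !inE => /andP[/orP[] /eqP ea /orP[] /eqP eb];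
    by move: ab n1 n2; rewrite ea eb !eqxx.
have sq : (\sum_(i in A) f i) ^+ 2 - \sum_(i in A) f i ^+ 2 = 2 * P 2.
  rewrite P2 expr2 big_distrlr /= -sumrB.
  transitivity (\sum_(i in A) \sum_(j in A | i != j) f i * f j).
    apply: eq_bigr => i iA; rewrite (bigD1 i) //= expr2 addrC addrK.
    by apply: eq_bigl => j; rewrite eq_sym.
  by rewrite pair_big_dep.
by rewrite sq P0 P1; ring.
Qed.

(** * Unbranched subgraphs as local choices at the vertices *)

(** Selects one ordered pair over each pair of distinct vertices and no diagonal pair, so that edges
    can be indexed within [V * V]. *)
Definition oriented (V : finType) (p : V * V) : bool :=
  (enum_rank p.1 < enum_rank p.2)%N.

(* A configuration s chooses at each vertex x a set s x of neighbours; it comes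
   from a set of edges when the two ends of every pair agree. *)
Definition ends (V : finType) (p : V * V) (s : {ffun V -> {set V}}) : bool * bool :=
  if oriented p then (p.2 \in s p.1, p.1 \in s p.2) else (false, false).

Definition unbranched_at (G : graph) (s : {ffun vertex G -> {set vertex G}}) x :=
  (s x \subset [set y | adj x y]) && (#|s x| <= 2)%N.

Section Configurations.
Variable G : graph.
Local Notation V := (vertex G).
Implicit Types (s : {ffun V -> {set V}}) (F : {set {set V}}).

Lemma orientedC (x y : V) : x != y -> oriented (y, x) = ~~ oriented (x, y).
Proof.
move=> xy; rewrite /oriented /= -leqNgt ltn_neqAle.
by rewrite (inj_eq val_inj) (inj_eq enum_rank_inj) eq_sym xy.
Qed.

(** Each choice of [y] at [x] is one end of exactly one oriented pair: the first end carries [u],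
    the second [v]. Regrouping by vertex separates the variables of different vertices. *)
Lemma prod_ends (K : comNzRingType) s (u v : V * V -> K) :
  (forall x, unbranched_at s x) ->
  let f x y := if oriented (x, y) then u (x, y) else v (y, x) in
  \prod_p (u p ^+ (ends p s).1 * v p ^+ (ends p s).2)
  = \prod_x \prod_(y in s x) f x y.
Proof.
move=> ok f; have irr x : x \notin s x.
  by apply/negP => xs; have /andP[/subsetP/(_ _ xs)] := ok x; rewrite inE adj_irr.
pose F (p : V * V) := f p.1 p.2 ^+ (p.2 \in s p.1).
transitivity (\prod_p F p); last first.
  rewrite (eq_bigr (fun p => F (p.1, p.2))) => [|[] //].
  rewrite -(pair_bigA _ (fun x y => F (x, y))) /=.
  apply: eq_bigr => x _; rewrite [RHS]big_mkcond /=; apply: eq_bigr => y _.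
  by rewrite /F /=; case: (y \in s x).
rewrite (bigID (@oriented V)) /= [X in _ * X]big1 ?mulr1; last first.
  by move=> p op; rewrite /ends (negbTE op) !expr0 mulr1.
rewrite [RHS](bigID (@oriented V)) /=.
(* Diagonal pairs contribute 1, as no vertex chooses itself; swapping makes the remaining ones
   oriented. *)
have -> : \prod_(p | ~~ oriented p) F p = \prod_(p | oriented p) F (p.2, p.1).
  rewrite (bigID (fun p : V * V => p.1 == p.2)) /= big1 ?mul1r; last first.
    by move=> [x y] /= /andP[_ /eqP ->]; rewrite /F /= (negbTE (irr y)).
  rewrite (reindex_onto (fun p : V * V => (p.2, p.1)) (fun p => (p.2, p.1))) /=; last by case.
  apply: eq_bigl => -[x y] /=; rewrite eqxx andbT.
  have [->|xy] := eqVneq x y; first by rewrite andbF /oriented ltnn.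
  by rewrite (orientedC xy) negbK andbT.
rewrite -big_split /=; apply: eq_bigr => -[x y] op; rewrite /ends op /F /f /= op.
rewrite orientedC 1?op //; apply: contraTneq op => ->; by rewrite /oriented ltnn.
Qed.

(** Before contraction the choices at distinct vertices are independent, so the sum factors into
    local polynomials, and [vertex_poly_neq0] applies to each. *)
Lemma configuration_sum_neq0 (R : rcfType) (p q s : R) (u v : V * V -> R[i]) :
  p ^+ 2 + q ^+ 2 = 1 -> 0 < s ->
  s * (max_degree G)%:R ^+ 2 + `|q| * ((max_degree G)%:R - 1)
    <= p * (max_degree G)%:R ->
  (forall e, half_plane p q s (u e)) -> (forall e, half_plane p q s (v e)) ->
  \sum_(t : {ffun V -> {set V}}) (\prod_x (unbranched_at t x)%:R) *
     \prod_e (u e ^+ (ends e t).1 * v e ^+ (ends e t).2) != 0.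
Proof.
move=> pq1 s0 sD Hu Hv.
pose f x y := if oriented (x, y) then u (x, y) else v (y, x).
pose loc x (B : {set V}) : R[i] :=
  ((B \subset [set y | adj x y]) && (#|B| <= 2)%N)%:R * \prod_(y in B) f x y.
have -> : \sum_(t : {ffun V -> {set V}}) (\prod_x (unbranched_at t x)%:R) *
     \prod_e (u e ^+ (ends e t).1 * v e ^+ (ends e t).2)
   = \sum_(t : {ffun V -> {set V}}) \prod_x loc x (t x).
  apply: eq_bigr => t _; rewrite /loc [RHS]big_split /=.
  have [ok|] := boolP [forall x, unbranched_at t x].
    by congr (_ * _); apply: (prod_ends u v); exact/forallP.
  rewrite negb_forall => /existsP[x /negbTE nx].
  by rewrite (bigD1 x) //= nx !mul0r.
rewrite -(bigA_distr_bigA loc); apply/prodf_neq0 => x _.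
have : 2 * \sum_B loc x B != 0.
  have -> : \sum_B loc x B = \sum_(B : {set V} | (B \subset [set y | adj x y])
      && (#|B| <= 2)%N) \prod_(y in B) f x y.
    rewrite [RHS]big_mkcond /=; apply: eq_bigr => B _; rewrite /loc.
    by case: (_ && _); rewrite ?mul1r ?mul0r.
  rewrite sum_subsets_le2; apply: (vertex_poly_neq0 pq1 s0 sD).
    exact: (leq_bigmax_cond (F := @degree G) x).
  by move=> y _; rewrite /f; case: ifP.
by apply: contraNneq => ->; rewrite mulr0.
Qed.

Definition choices F : {ffun V -> {set V}} := [ffun x => [set y | [set x; y] \in F]].

(** Reads only the choice made at the first end of a pair; it inverts [choices] on the symmetric
    configurations that satisfy [unbranched_at]. *)
Definition edge_set s : {set {set V}} :=
  [set [set p.1; p.2] | p : V * V & oriented p && (p.2 \in s p.1)].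

Lemma oriented_set2_inj : {in @oriented V &, injective (fun p : V * V => [set p.1; p.2])}.
Proof.
move=> [x y] [a b] /= oxy oab /= E.
have xy : x != y by apply: contraTneq oxy => ->; rewrite -topredE /= /oriented ltnn.
have : (a \in [set x; y]) && (b \in [set x; y]) by rewrite E !inE !eqxx orbT.
rewrite !inE => /andP[/orP[] /eqP ea /orP[] /eqP eb]; move: oab; rewrite ea eb //.
- by rewrite -topredE /= /oriented ltnn.
- by rewrite -topredE /= (orientedC xy) -[oriented _]/((x, y) \in @oriented V) oxy.
- by rewrite -topredE /= /oriented ltnn.
Qed.

Lemma mem_edge_set s x y :
  (forall x, unbranched_at s x) -> (forall x y, (y \in s x) = (x \in s y)) ->
  ([set x; y] \in edge_set s) = (y \in s x).
Proof.
move=> ok sym; have irr z : z \notin s z.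
  by apply/negP => xs; have /andP[/subsetP/(_ _ xs)] := ok z; rewrite inE adj_irr.
apply/imsetP/idP => [[[a b]]|ys].
  rewrite inE /= => /andP[oab bs] E.
  have ab : a != b by apply: contraTneq oab => ->; rewrite /oriented ltnn.
  have : (a \in [set x; y]) && (b \in [set x; y]) by rewrite E !inE !eqxx orbT.
  rewrite !inE => /andP[/orP[] /eqP ea /orP[] /eqP eb]; move: bs ab; rewrite ea eb ?eqxx //.
  by rewrite sym.
have xy : x != y by apply: contraTneq ys => ->; exact: irr.
have [oxy|oxy] := boolP (oriented (x, y)).
  by exists (x, y) => //; rewrite inE oxy.
exists (y, x); last by rewrite /= setUC.
by rewrite inE (orientedC xy) oxy /= -sym.
Qed.

Lemma edges_set2 (x y : V) : ([set x; y] \in edges G) = adj x y.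
Proof.
rewrite inE; apply/existsP/idP => [[a /existsP[b /andP[ab /eqP E]]]|xy]; last first.
  by exists x; apply/existsP; exists y; rewrite xy eqxx.
have nab : a != b by apply: contraTneq ab => ->; rewrite adj_irr.
have : (a \in [set x; y]) && (b \in [set x; y]) by rewrite E !inE !eqxx orbT.
rewrite !inE => /andP[/orP[] /eqP ea /orP[] /eqP eb]; move: ab nab; rewrite ea eb ?eqxx //.
by rewrite adj_sym.
Qed.

Lemma card_incident F x : F \subset edges G ->
  #|[set e in F | x \in e]| = #|choices F x|.
Proof.
move=> /subsetP FE; rewrite -(card_in_imset (f := fun y => [set x; y])); last first.
  move=> y z _ _ E; have : (y \in [set x; z]) && (z \in [set x; y]).
    by rewrite -E {2}E !inE !eqxx !orbT.
  rewrite !inE => /andP[/orP[]/eqP ey /orP[]/eqP ez]; congruence.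
congr #|pred_of_set _|; apply/setP => e; rewrite inE.
apply/andP/imsetP => [[eF xe]|[y]]; last first.
  by rewrite ffunE inE => xyF ->; rewrite !inE eqxx.
have := FE e eF; rewrite inE => /existsP[a /existsP[b /andP[ab /eqP E]]].
move: xe; rewrite E !inE => /orP[] /eqP ->.
  by exists b => //; rewrite ffunE inE -E.
by exists a; rewrite ?ffunE ?inE setUC -?E.
Qed.

(** Phrased as the side condition that reindexing configurations by [choices] and [edge_set]
    produces. *)
Lemma unbranched_choices F :
  unbranched F = [forall x, unbranched_at (choices F) x] && (edge_set (choices F) == F).
Proof.
have sym x y : (y \in choices F x) = (x \in choices F y) by rewrite !ffunE !inE setUC.
apply/andP/andP => [[FE /forallP F2]|[/forallP ok /eqP EF]].
  have ok x : unbranched_at (choices F) x.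
    rewrite /unbranched_at -card_incident // F2 andbT.
    by apply/subsetP => y; rewrite ffunE !inE => /(subsetP FE); rewrite edges_set2.
  split; first exact/forallP.
  apply/eqP/setP => e; apply/idP/idP => [/imsetP[[a b]]|eF].
    by rewrite !inE ffunE inE /= => /andP[_ abF] ->.
  have := subsetP FE e eF; rewrite inE => /existsP[a /existsP[b /andP[ab /eqP E]]].
  by rewrite E mem_edge_set // ffunE inE -E.
have FE : F \subset edges G.
  rewrite -EF; apply/subsetP => _ /imsetP[[a b] + ->]; rewrite inE /= => /andP[_ bs].
  by rewrite edges_set2; have /andP[/subsetP/(_ _ bs)] := ok a; rewrite inE.
split=> //; apply/forallP => x; rewrite card_incident //.
by have /andP[] := ok x.
Qed.

(** The contracted factor kills every configuration in which the ends of some pair disagree; the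
    surviving ones come from unbranched sets, with one [z] per edge. *)
Lemma contracted_sum (K : comNzRingType) (z : K) :
  \sum_(t : {ffun V -> {set V}}) (\prod_x (unbranched_at t x)%:R) *
     \prod_e (((ends e t).1 == (ends e t).2)%:R * z ^+ (ends e t).1)
  = \sum_(F | @unbranched G F) z ^+ #|F|.
Proof.
pose good (t : {ffun V -> {set V}}) :=
  [forall x, unbranched_at t x] && [forall x, forall y, (y \in t x) == (x \in t y)].
rewrite (bigID good) /= [X in _ + X]big1 ?addr0; last first.
  move=> t; rewrite negb_and => /orP[|].
    rewrite negb_forall => /existsP[x /negbTE nx].
    by rewrite (bigD1 x) //= nx !mul0r.
  have [ok|] := boolP [forall x, unbranched_at t x]; last first.
    rewrite negb_forall => /existsP[x /negbTE nx] _.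
    by rewrite (bigD1 x) //= nx !mul0r.
  rewrite negb_forall => /existsP[x]; rewrite negb_forall => /existsP[y xy].
  have nxy : x != y by apply: contraNneq xy => ->.
  rewrite mulrC; have [oxy|oxy] := boolP (oriented (x, y)).
    by rewrite (bigD1 (x, y)) //= /ends oxy /= (negbTE xy) !mul0r.
  by rewrite (bigD1 (y, x)) //= /ends orientedC // oxy /= eq_sym (negbTE xy) !mul0r.
rewrite (reindex_onto choices edge_set) /=; last first.
  move=> t /andP[/forallP ok /forallP sym]; apply/ffunP => x; apply/setP => y.
  rewrite ffunE inE mem_edge_set // => a b; have /forallP/(_ b)/eqP := sym a; exact.
apply: eq_big => F.
  rewrite unbranched_choices /good; congr andb; rewrite andbC -[RHS]andTb; congr andb.
  by apply/forallP => x; apply/forallP => y; rewrite !ffunE !inE setUC.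
move=> /andP[/andP[/forallP ok /forallP sym] /eqP EF].
rewrite big1 ?mul1r => [|x _]; last by rewrite ok.
transitivity (\prod_(e | oriented e && (e.2 \in choices F e.1)) z).
  rewrite [RHS]big_mkcond /=; apply: eq_bigr => -[x y] _; rewrite /ends /=.
  case: ifP => _ /=; last by rewrite mul1r expr0.
  have /forallP/(_ y)/eqP <- := sym x; rewrite eqxx mul1r.
  by case: (_ \in _).
rewrite prodr_const; congr (_ ^+ _).
rewrite -[in RHS]EF card_in_imset //; first by apply: eq_card => e; rewrite inE.
move=> p p'; rewrite !inE => /andP[op _] /andP[op' _]; exact: oriented_set2_inj.
Qed.

(* Ruelle's zero-free half-plane. *)
Lemma unbranched_poly_neq0 (R : rcfType) (z : R[i]) :
  (0 < max_degree G)%N -> - (2 * (max_degree G)%:R ^+ 3)^-1 < Re z ->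
  \sum_(F | @unbranched G F) z ^+ #|F| != 0.
Proof.
move=> D0 zD; have [p [q [s [pq1 s0 sD zs]]]] := parabolas_cover_half_plane D0 zD.
rewrite -contracted_sum.
apply: (asano_contraction_sum_neq0 (H := half_plane p q s)).
- by rewrite /half_plane /= !mulr0 addr0 oppr_lt0.
- by move=> a b c d; exact: asano_contraction_neq0.
- by move=> u v; exact: configuration_sum_neq0.
Qed.

End Configurations.

(** * Interpolation *)

(** Listing inverse zeros normalizes the value at 0 to 1 and turns absence of zeros in the open unit
    disk into [|e| <= 1]. *)
Definition prod_1sub (F : numFieldType) (s : seq F) : {poly F} :=
  \prod_(e <- s) (1 - e%:P * 'X).

(* Minus the Taylor polynomial of degree < K of the logarithmic derivative of
   [prod_1sub s]; its coefficients are the power sums of [s]. *)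
Definition power_sum_poly (F : numFieldType) (K : nat) (s : seq F) : {poly F} :=
  \sum_(e <- s) e%:P * \sum_(k < K) (e%:P * 'X) ^+ k.

Lemma power_sum_poly_size (F : numFieldType) (K : nat) (s : seq F) :
  (size (power_sum_poly K s) <= K)%N.
Proof.
rewrite /power_sum_poly; apply: (big_ind (fun p : {poly F} => (size p <= K)%N)).
- by rewrite size_poly0.
- by move=> p q hp hq; rewrite (leq_trans (size_polyD _ _)) // geq_max hp.
move=> e _; rewrite mul_polyC (leq_trans (size_scale_leq _ _)) //.
apply: (big_ind (fun p : {poly F} => (size p <= K)%N)).
- by rewrite size_poly0.
- by move=> p q hp hq; rewrite (leq_trans (size_polyD _ _)) // geq_max hp.
move=> k _; rewrite exprMn -polyC_exp mul_polyC (leq_trans (size_scale_leq _ _)) //.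
by rewrite size_polyXn.
Qed.

Lemma prod_1sub_horner0 (F : numFieldType) (s : seq F) : (prod_1sub s).[0] = 1.
Proof.
rewrite /prod_1sub horner_prod big1_seq // => e _.
by rewrite !hornerE ?mulr0 ?subr0.
Qed.

Lemma norm_1sub_ge (F : numFieldType) (e t : F) :
  `|e| <= 1 -> 0 <= t < 1 -> 1 - t <= `|1 - e * t|.
Proof.
move=> e1 /andP[t0 t1]; apply: le_trans (lerB_dist _ _).
by rewrite normr1 normrM (ger0_norm t0) lerD2l lerN2 ler_piMl.
Qed.

Lemma prod_1sub_horner_neq0 (F : numFieldType) (s : seq F) (t : F) :
  (forall e, e \in s -> `|e| <= 1) -> 0 <= t < 1 -> (prod_1sub s).[t] != 0.
Proof.
move=> s1 t01; rewrite /prod_1sub horner_prod prodf_seq_neq0; apply/allP => e es /=.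
rewrite !hornerE -normr_gt0; apply: lt_le_trans (norm_1sub_ge (s1 e es) t01).
by rewrite subr_gt0; case/andP: t01.
Qed.

(** The truncated geometric series of each factor leaves a tail: [M] divided by the product is minus
    the sum of [e^(K+1) / (1 - e t)], with terms of norm at most [1 / (1 - t)]. *)
Lemma deriv_prod_1sub (F : numFieldType) (K : nat) (s : seq F) :
  exists2 M : {poly F},
    (prod_1sub s)^`() + prod_1sub s * power_sum_poly K s = M * 'X^K &
    forall t : F, 0 <= t < 1 -> (forall e, e \in s -> `|e| <= 1) ->
      `|M.[t]| <= (size s)%:R / (1 - t) * `|(prod_1sub s).[t]|.
Proof.
elim: s => [|e s [M ME Mb]].
  exists 0; first by rewrite /prod_1sub /power_sum_poly !big_nil derivC mulr0 mul0r addr0.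
  by move=> t _ _; rewrite horner0 normr0 mul0r mul0r.
exists ((1 - e%:P * 'X) * M - (e ^+ K.+1)%:P * prod_1sub s).
  rewrite /prod_1sub /power_sum_poly !big_cons -/(prod_1sub s) -/(power_sum_poly K s).
  rewrite derivM derivB derivC sub0r derivM derivC mul0r add0r derivX mulr1.
  set g := \sum_(k < K) _.
  have gE : (1 - e%:P * 'X) * g = 1 - (e ^+ K)%:P * 'X^K.
    rewrite polyC_exp -exprMn; transitivity (- ((e%:P * 'X - 1) * g)); first by ring.
    by rewrite -subrX1 opprB.
  transitivity ((1 - e%:P * 'X) * ((prod_1sub s)^`() + prod_1sub s * power_sum_poly K s)
     + prod_1sub s * e%:P * ((1 - e%:P * 'X) * g - 1)); first by ring.
  by rewrite ME gE !polyC_exp exprS; ring.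
move=> t t01 s1; have se x : x \in s -> `|x| <= 1 by move=> xs; rewrite s1 // in_cons xs orbT.
have e1 : `|e| <= 1 by rewrite s1 // mem_head.
have t1 : 0 < 1 - t by rewrite subr_gt0; case/andP: t01.
rewrite /prod_1sub big_cons -/(prod_1sub s) hornerM hornerD hornerN !hornerM !hornerE.
set p := (prod_1sub s).[t].
apply: le_trans (ler_normB _ _) _; rewrite !normrM /= -natr1 !mulrDl lerD //.
  rewrite mulrCA ler_wpM2l ?normr_ge0 //; exact: Mb.
rewrite div1r mulrA ler_wpM2r ?normr_ge0 //.
apply: (@le_trans _ _ 1); first by rewrite normrX exprn_ile1 ?normr_ge0.
by rewrite mulrC ler_pdivlMr // mul1r norm_1sub_ge.
Qed.

(** Newton's identities by divisibility: [X^K] divides [P1 (N1 - N2)] and is coprime to [P1], while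
    [N1 - N2] has degree below [K]. *)
Lemma eq_power_sum_poly (F : numFieldType) (K : nat) (s1 s2 : seq F) :
  (forall k, (k <= K)%N -> (prod_1sub s1)`_k = (prod_1sub s2)`_k) ->
  power_sum_poly K s1 = power_sum_poly K s2.
Proof.
move=> eqc.
have [M1 E1 _] := deriv_prod_1sub K s1; have [M2 E2 _] := deriv_prod_1sub K s2.
set P1 := prod_1sub s1 in eqc E1; set P2 := prod_1sub s2 in eqc E2.
set N1 := power_sum_poly K s1 in E1 *; set N2 := power_sum_poly K s2 in E2 *.
(* Agreement is needed up to order [K] inclusive because differentiation costs one power of [X]. *)
pose W := drop_poly K.+1 (P1 - P2).
have WE : P1 - P2 = W * 'X^(K.+1).
  rewrite -[LHS](poly_take_drop K.+1) -/W -[RHS]add0r; congr (_ + _).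
  apply/polyP => k; rewrite coef_take_poly coef0 coefB ltnS.
  by case: leqP => // kK; rewrite eqc // subrr.
have dv : dvdp 'X^K (P1 * (N1 - N2)).
  have -> : P1 * (N1 - N2) = (M1 - M2 - W^`() * 'X - W *+ K.+1 - W * 'X * N2) * 'X^K.
    have -> : P1 * (N1 - N2) = (P1^`() + P1 * N1) - (P2^`() + P2 * N2)
        - (P1 - P2)^`() - (P1 - P2) * N2 by rewrite derivB; ring.
    by rewrite E1 E2 WE derivM derivXn /= exprS -[W *+ _]mulr_natr -mulr_natr; ring.
  exact: dvdp_mulIr.
have cop : coprimep 'X^K P1.
  by rewrite coprimep_expl // coprimep_sym coprimepX /root prod_1sub_horner0 oner_eq0.
move: dv; rewrite Gauss_dvdpr //.
apply: contraTeq; rewrite -subr_eq0 => N0; apply/negP => /dvdp_leq => /(_ N0).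
rewrite size_polyXn ltnNge => /negP; apply.
by rewrite (leq_trans (size_polyD _ _)) // geq_max size_polyN !power_sum_poly_size.
Qed.

Lemma normr_real_complex (R : rcfType) (x : R) : `|x%:C| = `|x|%:C.
Proof. by rewrite normc_def /= expr0n addr0 sqrtr_sqr. Qed.

(** Both logarithmic derivatives contain the same power-sum polynomial; it cancels and only the two
    tails of order [t^K] remain. *)
Lemma log_derivative_close (R : rcfType) (K n : nat) (r1 r2 : {poly R})
    (s1 s2 : seq R[i]) (t : R) :
  map_poly (real_complex R) r1 = prod_1sub s1 ->
  map_poly (real_complex R) r2 = prod_1sub s2 ->
  (size s1 <= n)%N -> (size s2 <= n)%N ->
  (forall e, e \in s1 -> `|e| <= 1) -> (forall e, e \in s2 -> `|e| <= 1) ->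
  (forall k, (k <= K)%N -> r1`_k = r2`_k) -> 0 <= t < 1 ->
  `|r1^`().[t] / r1.[t] - r2^`().[t] / r2.[t]| <= 2 * n%:R * t ^+ K / (1 - t).
Proof.
move=> E1 E2 n1 n2 b1 b2 eqc t01; have /andP[t0 t1] := t01.
have tC : 0 <= t%:C < 1 by rewrite -(rmorph1 (real_complex R)) ltcR ler0c.
have eqN : power_sum_poly K s1 = power_sum_poly K s2.
  by apply: eq_power_sum_poly => k kK; rewrite -E1 -E2 !coef_map /= eqc.
have [M1 D1 /(_ _ tC b1) bM1] := deriv_prod_1sub K s1.
have [M2 D2 /(_ _ tC b2) bM2] := deriv_prod_1sub K s2.
have p1 := prod_1sub_horner_neq0 b1 tC; have p2 := prod_1sub_horner_neq0 b2 tC.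
rewrite -lecR -normr_real_complex.
have quo (r : {poly R}) (s : seq R[i]) (M : {poly R[i]}) :
    map_poly (real_complex R) r = prod_1sub s -> (prod_1sub s).[t%:C] != 0 ->
    (prod_1sub s)^`() + prod_1sub s * power_sum_poly K s = M * 'X^K ->
    (r^`().[t] / r.[t])%:C
    = M.[t%:C] / (prod_1sub s).[t%:C] * t%:C ^+ K - (power_sum_poly K s).[t%:C].
  move=> E p0 D; rewrite rmorphM fmorphV -!horner_map -deriv_map E.
  have := congr1 (fun p => p.[t%:C]) D; rewrite /= !hornerE => D'.
  apply: (mulIf p0); rewrite divfK // mulrBl mulrAC divfK // -D'; ring.
rewrite rmorphB /= (quo _ _ _ E1 p1 D1) (quo _ _ _ E2 p2 D2) eqN.
rewrite opprB addrA subrK -mulrBl normrM normrX (ger0_norm (andP tC).1).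
have -> : (2 * n%:R * t ^+ K / (1 - t))%:C
          = (n%:R / (1 - t%:C) + n%:R / (1 - t%:C)) * t%:C ^+ K.
  rewrite !rmorphM fmorphV rmorphB rmorphXn !rmorph_nat rmorph1 /=; ring.
have t1C : 0 < 1 - t%:C by rewrite subr_gt0; case/andP: tC.
rewrite ler_wpM2r ?exprn_ge0 ?ler0c // (le_trans (ler_normB _ _)) // lerD //.
  rewrite normrM normfV ler_pdivrMr ?normr_gt0 // (le_trans bM1) //.
  by rewrite ler_wpM2r // ler_wpM2r ?invr_ge0 ?(ltW t1C) // ler_nat.
rewrite normrM normfV ler_pdivrMr ?normr_gt0 // (le_trans bM2) //.
by rewrite ler_wpM2r // ler_wpM2r ?invr_ge0 ?(ltW t1C) // ler_nat.
Qed.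

(** Mean value theorem on [[0, w]]: the difference of the logarithms vanishes at 0, where the
    constant coefficients agree, and the bound on its derivative increases with [t]. *)
Lemma ln_horner_close (R : realType) (K n : nat) (r1 r2 : {poly R})
    (s1 s2 : seq R[i]) (w : R) :
  map_poly (real_complex R) r1 = prod_1sub s1 ->
  map_poly (real_complex R) r2 = prod_1sub s2 ->
  (size s1 <= n)%N -> (size s2 <= n)%N ->
  (forall e, e \in s1 -> `|e| <= 1) -> (forall e, e \in s2 -> `|e| <= 1) ->
  (forall k, (k <= K)%N -> r1`_k = r2`_k) ->
  (forall t, 0 <= t < 1 -> 0 < r1.[t]) -> (forall t, 0 <= t < 1 -> 0 < r2.[t]) ->
  0 < w < 1 ->
  `|ln r1.[w] - ln r2.[w]| <= 2 * n%:R * w ^+ K / (1 - w).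
Proof.
move=> E1 E2 n1 n2 b1 b2 eqc pos1 pos2 /andP[w0 w1].
pose f (t : R) : R := ln r1.[t] - ln r2.[t].
pose df t : R := r1.[t]^-1 * r1^`().[t] - r2.[t]^-1 * r2^`().[t].
have der (t : R) : 0 <= t < 1 -> is_derive t 1 f (df t).
  move=> t01.
  have h1 := is_derive1_comp (is_derive1_ln (pos1 t t01)) (is_derive_poly r1 t).
  have h2 := is_derive1_comp (is_derive1_ln (pos2 t t01)) (is_derive_poly r2 t).
  exact: is_deriveB h1 h2.
have in01 (t : R) : t \in `[0, w] -> 0 <= t < 1.
  by rewrite in_itv /= => /andP[-> /le_lt_trans]; exact.
have [] := @MVT R f df 0 w w0.
- by move=> t tw; apply: der; apply: in01; exact: subset_itv_oo_cc tw.
- apply: derivable_within_continuous => t tw.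
  by have [] := der t (in01 t tw).
move=> c cw; have c01 := in01 c (subset_itv_oo_cc cw).
have f0 : f 0 = 0.
  by rewrite /f !horner_coef0 eqc // subrr.
rewrite f0 !subr0 => fw.
have -> : ln r1.[w] - ln r2.[w] = f w by [].
have /andP[c0 cw'] : 0 < c < w by move: cw; rewrite in_itv.
rewrite fw normrM (gtr0_norm w0) (le_trans (ler_piMr _ (ltW w1))) //.
rewrite /df mulrC [_^-1 * r2^`().[c]]mulrC.
apply: (le_trans (log_derivative_close E1 E2 n1 n2 b1 b2 eqc c01)).
rewrite -!mulrA ler_wpM2l // ler_wpM2l // ler_pM //.
- by rewrite exprn_ge0 // ltW.
- by rewrite invr_ge0; lra.
- by rewrite lerXn2r ?nnegrE ?ltW.
- by rewrite lef_pV2 ?posrE; lra.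
Qed.

(* (1 - w)^n times the polynomial with coefficients u at 2dw/(1 - w), a map of
   the unit disk onto the half-plane Re z > -d. *)
Definition disk_poly (F : fieldType) (n : nat) (d : F) (u : nat -> F) : {poly F} :=
  \sum_(k < n.+1) (u k * (2 * d) ^+ k) *: ('X^k * (1 - 'X) ^+ (n - k)).

Lemma map_disk_poly (F K : fieldType) (f : {rmorphism F -> K}) n (d : F) u :
  map_poly f (disk_poly n d u) = disk_poly n (f d) (f \o u).
Proof.
rewrite /disk_poly rmorph_sum; apply: eq_bigr => k _ /=.
by rewrite map_polyZ !rmorphM !rmorphXn /= rmorphB rmorph1 rmorphM rmorph_nat /= map_polyX.
Qed.

(** The term of index [k] is divisible by [X^k], so the change of variable is triangular on
    coefficients. *)
Lemma coef_disk_poly (F : fieldType) n K (d : F) (u1 u2 : nat -> F) :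
  (forall k, (k <= K)%N -> u1 k = u2 k) ->
  forall j, (j <= K)%N -> (disk_poly n d u1)`_j = (disk_poly n d u2)`_j.
Proof.
move=> u12 j jK; rewrite /disk_poly !coef_sum; apply: eq_bigr => k _.
rewrite !coefZ coefXnM; case: ltnP => [_|kj]; first by rewrite !mulr0.
by rewrite u12 // (leq_trans kj).
Qed.

Lemma size_disk_poly (F : fieldType) n (d : F) u : (size (disk_poly n d u) <= n.+1)%N.
Proof.
rewrite /disk_poly; apply: (big_ind (fun p : {poly F} => (size p <= n.+1)%N)).
- by rewrite size_poly0.
- by move=> p q hp hq; rewrite (leq_trans (size_polyD _ _)) // geq_max hp.
move=> k _; rewrite (leq_trans (size_scale_leq _ _)) //.
have e : size (1 - 'X : {poly F}) = 2 by rewrite -size_polyN opprB size_XsubC.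
rewrite (leq_trans (size_polyMleq _ _)) // size_polyXn addSn /=.
have := size_poly_exp_leq (1 - 'X : {poly F}) (n - k); rewrite e mul1n => h.
by rewrite (leq_trans (leq_add (leqnn _) h)) // addnS subnKC // -ltnS.
Qed.

Lemma horner_disk_poly (F : fieldType) n (d : F) u (w : F) : w != 1 ->
  (disk_poly n d u).[w]
  = (1 - w) ^+ n * \sum_(k < n.+1) u k * (2 * d * w / (1 - w)) ^+ k.
Proof.
move=> w1; have w1' : 1 - w != 0 by rewrite subr_eq0 eq_sym.
rewrite /disk_poly horner_sum mulr_sumr; apply: eq_bigr => k _.
rewrite hornerZ hornerM hornerXn horner_exp !hornerE.
have kn : (k <= n)%N by rewrite -ltnS.
have -> : (1 - w) ^+ n = (1 - w) ^+ (n - k) * (1 - w) ^+ k by rewrite -exprD subnK.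
move: (2 * d) => c; rewrite expr_div_n exprMn /=.
by move: ((1 - w) ^+ (n - k)) => a; field; rewrite expf_neq0.
Qed.

(** A zero in the open unit disk would be carried to a zero in the half-plane; hence inverse zeros
    have norm at most 1. The value 1 at the origin fixes the scalar factor. *)
Lemma disk_poly_factor (R : rcfType) (n : nat) (d : R) (u : nat -> R) :
  0 < d -> u 0%N = 1 ->
  (forall z : R[i], - d < Re z -> \sum_(k < n.+1) (u k)%:C * z ^+ k != 0) ->
  exists s : seq R[i], [/\ (size s <= n)%N, forall e, e \in s -> `|e| <= 1 &
    map_poly (real_complex R) (disk_poly n d u) = prod_1sub s].
Proof.
move=> d0 u0 nz; set P := map_poly _ _.
have PE : P = disk_poly n d%:C (fun k => (u k)%:C) by exact: map_disk_poly.
have P0 : P.[0] = 1.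
  rewrite PE horner_disk_poly 1?eq_sym ?oner_eq0 // subr0 expr1n mul1r mulr0 mul0r.
  by rewrite big_ord_recl /= u0 big1 ?addr0 ?expr0 ?mulr1 // => k _; rewrite exprS mul0r mulr0.
have [r Pr] := closed_field_poly_normal P.
have Pn0 : P != 0 by apply: contra_eq_neq P0 => ->; rewrite horner0 eq_sym oner_eq0.
have rn : (size r <= n)%N.
  rewrite -ltnS -(size_prod_XsubC r id) -(size_scale _ (a := lead_coef P)) ?lead_coef_eq0 //.
  by rewrite -Pr PE size_disk_poly.
have root0 z : z \in r -> P.[z] = 0.
  by rewrite -root_prod_XsubC => /rootP zr; rewrite Pr hornerZ zr mulr0.
have r0 z : z \in r -> z != 0.
  by move=> /root0 z0; apply: contra_eq_neq z0 => ->; rewrite P0 oner_eq0.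
exists (map (fun z => z^-1) r); split; first by rewrite size_map.
- move=> _ /mapP[z zr ->]; rewrite normfV invf_le1 ?normr_gt0 ?r0 //.
  rewrite real_leNgt ?realn ?real1 ?normr_real //; apply/negP => z1; have := root0 z zr.
  have zn1 : z != 1 by apply: contraTneq z1 => ->; rewrite normr1 ltxx.
  rewrite PE horner_disk_poly // => /eqP; apply/negP.
  apply: mulf_neq0; first by rewrite expf_neq0 // subr_eq0 eq_sym.
  apply: nz.
  case: z z1 {zr zn1} => x y z1.
  have xy1 : x ^+ 2 + y ^+ 2 < 1.
    by move: z1; rewrite normc_def -(rmorph1 (real_complex R)) ltcR -[ltRHS]sqrtr1 ltr_sqrt.
  have q0 : 0 < (1 - x) ^+ 2 + y ^+ 2.
    rewrite lt_def addr_ge0 ?sqr_ge0 // andbT; apply/eqP => e; move: xy1.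
    by have := sqr_ge0 (1 - x); have := sqr_ge0 y; nra.
  suff -> : Re (2 * d%:C * (x +i* y) / (1 - (x +i* y)))
      = 2 * d * (x * (1 - x) - y ^+ 2) / ((1 - x) ^+ 2 + y ^+ 2).
    (* After clearing the denominator, exceeding [- d] is exactly [x^2 + y^2 < 1]. *)
    by rewrite ltr_pdivlMr //; nra.
  by rewrite /= ?sub0r ?sqrrN; field; rewrite gt_eqF.
have e : \prod_(z <- r) ('X - z%:P) = (\prod_(z <- r) (- z))%:P * prod_1sub (map (fun z => z^-1) r).
  rewrite /prod_1sub big_map rmorph_prod /= -big_split /= big_seq [RHS]big_seq.
  apply: eq_bigr => z zr; rewrite mulrBr mulr1 mulrA -polyCM mulNr divff ?r0 //.
  by rewrite !polyCN polyC1 mulN1r opprK addrC.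
have c1 : lead_coef P * \prod_(z <- r) (- z) = 1.
  by rewrite -[RHS]P0 [in RHS]Pr e hornerZ hornerM prod_1sub_horner0 mulr1 hornerC.
by rewrite [LHS]Pr e -mul_polyC mulrA -polyCM c1 polyC1 mul1r.
Qed.

(** * Application to graphs and the choice of the constant *)

Lemma card_edges_le (G : graph) : (#|edges G| <= #|vertex G| ^ 2)%N.
Proof.
have -> : (#|vertex G| ^ 2 = #|{: vertex G * vertex G}|)%N by rewrite card_prod expnS expn1.
apply: leq_trans (leq_imset_card (fun p => [set p.1; p.2]) _).
apply/subset_leq_card/subsetP => e; rewrite inE => /existsP[x /existsP[y /andP[_ /eqP ->]]].
by apply/imsetP; exists (x, y).
Qed.

Lemma sum_unbranched (K : comNzRingType) (G : graph) (n : nat) (z : K) :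
  (#|edges G| <= n)%N ->
  \sum_(F | @unbranched G F) z ^+ #|F|
  = \sum_(k < n.+1) (num_unbranched_of_size G k)%:R * z ^+ k.
Proof.
move=> En.
rewrite (partition_big (fun F : {set {set vertex G}} => inord #|F| : 'I_n.+1) xpredT) //=.
apply: eq_bigr => k _.
rewrite (eq_bigr (fun=> z ^+ k)) => [|F /andP[/andP[FE _] /eqP <-]]; last first.
  by rewrite inordK // ltnS (leq_trans (subset_leq_card FE)).
rewrite sumr_const mulr_natl; congr (_ *+ _); apply: eq_card => F.
rewrite [LHS]unfold_in /= !inE; case: (boolP (unbranched F)) => //= /andP[FE _].
by rewrite -val_eqE /= inordK // ltnS (leq_trans (subset_leq_card FE)).
Qed.

Lemma unbranched0 (G : graph) : @unbranched G set0.
Proof.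
rewrite /unbranched sub0set; apply/forallP => x.
by rewrite (_ : [set e in _ | _] = set0) ?cards0 //; apply/setP => e; rewrite !inE.
Qed.

Lemma num_unbranched_of_size0 (G : graph) : num_unbranched_of_size G 0 = 1%N.
Proof.
rewrite /num_unbranched_of_size -(cards1 (set0 : {set {set vertex G}})).
congr #|pred_of_set _|; apply/setP => F; rewrite !inE cards_eq0 andbC.
by case: eqVneq => // ->; rewrite unbranched0.
Qed.

Lemma num_unbranched_gt0 (G : graph) : (0 < num_unbranched G)%N.
Proof. by apply/card_gt0P; exists set0; rewrite inE unbranched0. Qed.

Lemma num_unbranched_max_degree0 (G : graph) : max_degree G = 0%N -> num_unbranched G = 1%N.
Proof.
move=> D0; have E0 : edges G = set0.
  apply/setP => e; rewrite !inE; apply/negbTE/existsP => -[x /existsP[y /andP[xy _]]].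
  have := @leq_bigmax_cond _ xpredT (@degree G) x isT.
  rewrite -/(max_degree G) D0 leqn0 cards_eq0 => /eqP/setP/(_ y).
  by rewrite !inE xy.
rewrite /num_unbranched -(cards1 (set0 : {set {set vertex G}})).
congr #|pred_of_set _|; apply/setP => F; rewrite !inE.
apply/idP/eqP => [/andP[]|->]; last exact: unbranched0.
by rewrite E0 subset0 => /eqP.
Qed.

Lemma ln_num_unbranched_close (R : realType) (v D K : nat) (G1 G2 : graph) :
  (0 < D)%N -> #|vertex G1| = v -> #|vertex G2| = v ->
  max_degree G1 = D -> max_degree G2 = D ->
  (forall k, (k <= K)%N -> num_unbranched_of_size G1 k = num_unbranched_of_size G2 k) ->
  `|ln ((num_unbranched G1)%:R : R) - ln (num_unbranched G2)%:R|
    <= 2 * v%:R ^+ 2 * (1 + D%:R ^- 3) ^- K * (1 + D%:R ^+ 3).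
Proof.
move=> D0 v1 v2 D1 D2 eqK; pose d : R := (2 * D%:R ^+ 3)^-1.
have Dp : 0 < D%:R ^+ 3 :> R by rewrite exprn_gt0 // ltr0n.
have d0 : 0 < d by rewrite invr_gt0 mulr_gt0.
(* The point of the disk that is mapped to [z = 1], the solution of [2 d w / (1 - w) = 1]. *)
pose w : R := (1 + D%:R ^- 3)^-1.
have iD : 0 < D%:R ^- 3 :> R by rewrite invr_gt0.
have w0 : 0 < w by rewrite invr_gt0; lra.
have w1 : w < 1 by rewrite invf_lt1; lra.
have wV : (1 - w)^-1 = 1 + D%:R ^+ 3.
  rewrite /w; set a : R := D%:R ^+ 3 in Dp *; field.
  by rewrite !gt_eqF //; lra.
pose c G : nat -> R := fun k => (num_unbranched_of_size G k)%:R.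
(* The degree bound [v ^ 2] is common to both graphs, so the power of [1 - w] cancels in the
   difference of logarithms. *)
pose r G := disk_poly (v ^ 2) d (c G).
have main G : #|vertex G| = v -> max_degree G = D ->
    [/\ exists s : seq R[i], [/\ (size s <= v ^ 2)%N, forall e, e \in s -> `|e| <= 1 &
          map_poly (real_complex R) (r G) = prod_1sub s],
        forall t, 0 <= t < 1 -> 0 < (r G).[t] &
        (r G).[w] = (1 - w) ^+ (v ^ 2) * (num_unbranched G)%:R].
  move=> vG DG; have Ev : (#|edges G| <= v ^ 2)%N by rewrite -vG card_edges_le.
  split.
  - apply: disk_poly_factor => //; first by rewrite /c num_unbranched_of_size0.
    move=> z zd; have := @unbranched_poly_neq0 G R z.
    rewrite DG => /(_ D0 zd); rewrite (sum_unbranched _ Ev).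
    by under eq_bigr do rewrite -(rmorph_nat (real_complex R)).
  - move=> t /andP[t0 t1]; rewrite horner_disk_poly ?lt_eqF //.
    rewrite mulr_gt0 ?exprn_gt0 ?subr_gt0 // big_ord_recl /c num_unbranched_of_size0.
    rewrite expr0 mulr1 ltr_pwDl // sumr_ge0 // => k _.
    by rewrite mulr_ge0 ?exprn_ge0 ?divr_ge0 ?subr_ge0 ?mulr_ge0 ?(ltW t1) ?(ltW d0) ?ler0n.
  - rewrite horner_disk_poly ?lt_eqF //; congr (_ * _).
    have -> : 2 * d * w / (1 - w) = 1.
      have y0 : 0 < D%:R :> R by rewrite ltr0n.
      rewrite /d /w; move: (D%:R : R) y0 => y y0; field.
      by rewrite !gt_eqF //; have := exprn_gt0 3 y0; nra.
    rewrite -(sum_unbranched 1 Ev).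
    rewrite (eq_bigr (fun=> 1)) => [|F _]; last by rewrite expr1n.
    by rewrite sumr_const -[LHS]mulr_natl mulr1 /num_unbranched cardsE.
have [[s1 [n1 b1 E1]] pos1 H1] := main _ v1 D1.
have [[s2 [n2 b2 E2]] pos2 H2] := main _ v2 D2.
have := @ln_horner_close R K (v ^ 2) (r G1) (r G2) s1 s2 w E1 E2 n1 n2 b1 b2.
rewrite w0 w1 => h.
have eqc k : (k <= K)%N -> (r G1)`_k = (r G2)`_k.
  by move=> kK; apply: (coef_disk_poly _ _ _ kK) => j jK; rewrite /c eqK.
have := h eqc pos1 pos2 isT.
rewrite H1 H2 !lnM ?posrE ?exprn_gt0 ?subr_gt0 ?ltr0n ?num_unbranched_gt0 //.
have -> (a b x : R) : a + b - (a + x) = b - x by ring.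
by rewrite wV natrX /w exprVn.
Qed.

(** With [a = D^3], [w <= exp (- 1 / (1 + a))] and [1 + a <= 2 a], so the constant 16 gives
    [w^(K+1) <= (eps / v)^8]. The eighth power absorbs the factor of order [v^5] in front. *)
Lemma interpolation_error (R : realType) (v D K : nat) (eps : R) :
  (0 < D <= v)%N -> (1 < v)%N -> 0 < eps < 1 ->
  16 * D%:R ^+ 3 * ln (v%:R / eps) < K.+1%:R ->
  2 * v%:R ^+ 2 * (1 + D%:R ^- 3) ^- K * (1 + D%:R ^+ 3) <= eps.
Proof.
move=> /andP[D0 Dv] v1 /andP[e0 e1]; set x : R := v%:R; set y : R := D%:R => KL.
have y1 : 1 <= y by rewrite ler1n.
have yx : y <= x by rewrite ler_nat.
have x2 : 2 <= x by rewrite ler_nat.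
set a := y ^+ 3 in KL *.
have a1 : 1 <= a by rewrite exprn_ege1.
have ax : a <= x ^+ 3 by rewrite lerXn2r ?nnegrE //; lra.
set w := (1 + a^-1)^-1.
have wE : w = 1 - (1 + a)^-1 by rewrite /w; field; lra.
have ex : 0 < eps / x by rewrite divr_gt0 //; lra.
have wK : w ^+ K.+1 <= (eps / x) ^+ 8.
  have -> : (eps / x) ^+ 8 = expR (- (8 * ln (x / eps))).
    rewrite -[x / eps]invrK invf_div lnV ?posrE // mulrN opprK.
    by rewrite expRM_natl lnK ?posrE.
  apply: (@le_trans _ _ (expR (- (K.+1%:R / (1 + a))))).
    rewrite -mulrN expRM_natl lerXn2r ?nnegrE ?expR_ge0 //.
      by rewrite wE subr_ge0 invf_le1; lra.
    by rewrite wE expR_ge1Dx.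
  rewrite ler_expR lerN2 ler_pdivlMr; last lra.
  apply: le_trans (ltW KL).
  have L0 : 0 <= ln (x / eps) by rewrite ln_ge0 // ler_pdivlMr // mul1r; lra.
  nra.
(* Passing from exponent [K.+1] to [K] costs a factor of at most 2. *)
have w2 : 2^-1 <= w by rewrite wE; have : (1 + a)^-1 <= 2^-1 by [rewrite lef_pV2 ?posrE; lra]; lra.
have wK' : w ^+ K <= 2 * (eps / x) ^+ 8.
  have wK0 : 0 <= w ^+ K by rewrite exprn_ge0 //; lra.
  by move: wK; rewrite exprS; nra.
have -> : (1 + a^-1) ^- K = w ^+ K by rewrite exprVn.
have b : 1 + a <= 2 * x ^+ 3 by lra.
apply: (@le_trans _ _ (2 * x ^+ 2 * (2 * (eps / x) ^+ 8) * (2 * x ^+ 3))).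
  apply: ler_pM => //; try lra.
    by rewrite !mulr_ge0 ?sqr_ge0 // exprn_ge0 //; lra.
  by rewrite ler_wpM2l // mulr_ge0 // sqr_ge0.
have -> : 2 * x ^+ 2 * (2 * (eps / x) ^+ 8) * (2 * x ^+ 3) = 8 / x ^+ 3 * eps ^+ 8.
  by field; lra.
have h8 : 8 / x ^+ 3 <= 1.
  rewrite ler_pdivrMr ?mul1r; last by rewrite exprn_gt0 //; lra.
  have -> : 8 = 2 ^+ 3 :> R by ring.
  by rewrite lerXn2r ?nnegrE //; lra.
have he : eps ^+ 8 <= eps by rewrite exprS ler_piMr ?exprn_ile1 // ltW.
rewrite -[leRHS]mul1r ler_pM //; last by rewrite exprn_ge0 // ltW.
by rewrite divr_ge0 // exprn_ge0 //; lra.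
Qed.

Lemma approximates_nat (R : realType) (a b : nat) (eps : R) :
  (0 < a)%N -> (0 < b)%N -> `|ln (a%:R : R) - ln b%:R| <= eps ->
  approximates (b%:R : R[i]) a%:R eps.
Proof.
move=> a0 b0 ab; exists (ln a%:R)%:C, (ln b%:R)%:C; split.
- by rewrite /cexp /= cos0 sin0 mulr1 mulr0 lnK ?posrE ?ltr0n // -(rmorph_nat (real_complex R)).
- by rewrite /cexp /= cos0 sin0 mulr1 mulr0 lnK ?posrE ?ltr0n // -(rmorph_nat (real_complex R)).
- by rewrite -rmorphB normr_real_complex lecR.
Qed.

Theorem theorem1p5 (R : realType) :
  exists2 c : R, 0 < c &
    forall (v D : nat) (eps : R),
      (1 <= v)%N -> 0 < eps < 1 ->
      let K : nat := Num.truncn (c * D%:R ^+ 3 * ln (v%:R / eps)) in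
      exists2 Phi : K.+1.-tuple nat -> R[i],
        (forall t, Phi t != 0) &
        forall G : graph, #|vertex G| = v -> max_degree G = D ->
          approximates (Phi [tuple num_unbranched_of_size G k | k < K.+1])
                       (num_unbranched G)%:R eps.
Proof.
exists 16 => // v D eps v1 e01; set K := Num.truncn _; cbv zeta.
pose rep t (H : graph) := [/\ #|vertex H| = v, max_degree H = D &
  t = [tuple num_unbranched_of_size H k | k < K.+1]].
(* Classical choice of a graph with the given numbers; the default 1 keeps the value nonzero when
   there is none. *)
pose Phi t : R[i] := if pselect (exists H, rep t H) is left h
  then (num_unbranched (projT1 (cid h)))%:R else 1.
exists Phi => [t|G vG DG]; rewrite /Phi; case: pselect => [h|nh].
- by rewrite pnatr_eq0 -lt0n num_unbranched_gt0.
- exact: oner_neq0.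
- case: (cid h) => H [vH DH eqt] /=.
  apply: approximates_nat; rewrite ?num_unbranched_gt0 //.
  have [D0|D0] := posnP D.
    by rewrite !num_unbranched_max_degree0 ?DG ?DH // subrr normr0; case/andP: e01 => /ltW.
  have eqK k : (k <= K)%N -> num_unbranched_of_size G k = num_unbranched_of_size H k.
    move=> kK; have := congr1 (fun t => tnth t (Ordinal (kK : (k < K.+1)%N))) eqt.
    by rewrite !tnth_mktuple.
  apply: le_trans (ln_num_unbranched_close R D0 vG vH DG DH eqK) _.
  (* No vertex is its own neighbour. With [0 < D] this also yields [1 < v]. *)
  have Dv : (D < v)%N.
    rewrite -DG -vG -ltnS -(ltn_predK (n := #|vertex G|) (m := 0)) ?vG //.
    rewrite !ltnS; apply/bigmax_leqP => x _; rewrite -ltnS (ltn_predK (m := 0)) // -vG.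
    rewrite -cardsT proper_card // properE subsetT /=; apply/subsetPn.
    by exists x; rewrite // inE adj_irr.
  apply: interpolation_error => //; first by rewrite D0 ltnW.
    exact: leq_ltn_trans D0 Dv.
  rewrite -truncn_lt_nat //; rewrite !mulr_ge0 ?exprn_ge0 // ln_ge0 //.
  case/andP: e01 => e0 e1; rewrite ler_pdivlMr // mul1r (le_trans (ltW e1)) //.
  by rewrite ler1n.
- by case: nh; exists G.
Qed.
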